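(* Let $L_1$ and $L_2$ be multiplicative lattices, let $\delta$ be an expansion function on $L_1$ and on $L_2$ having the global property, and let $\phi$ be a function on $L_1$ and on $L_2$ having the global property. Let $f:L_1\to L_2$ be a lattice isomorphism. Then a proper element $a\in L_1$ is $\phi$-$\delta$-primary if and only if $f(a)\in L_2$ is $\phi$-$\delta$-primary.
   Context: A multiplicative lattice is a complete lattice (least element $0$, greatest element $1$) with a commutative, associative multiplication that distributes over arbitrary joins and for which $1$ is the identity. Throughout the paper, multiplicative lattices are assumed compactly generated (every element is a join of compact elements), with $1$ compact and finite products of compact elements compact. A lattice isomorphism between multiplicative lattices is a bijection preserving order (joins and meets) in both directions and preserving multiplication. An expansion function on $L$ is $\delta:L\to L$ with $a\leqslant\delta(a)$ for all $a$, and $a\leqslant b$ implies $\delta(a)\leqslant\delta(b)$. Functions $\phi:L\to L$ are assumed to satisfy $\phi(a)\leqslant a$ for all $a$. ''A function $\beta$ on $L_1$ and on $L_2$'' means that a function $L_1\to L_1$ and a function $L_2\to L_2$ are given, both denoted $\beta$; it has the global property if for every lattice isomorphism $f:L_1\to L_2$, $\beta(f^{-1}(a))=f^{-1}(\beta(a))$ for all $a\in L_2$. An element $p$ is proper if $p<1$. A proper element $p\in L$ is $\phi$-$\delta$-primary if for all $a,b\in L$, $ab\leqslant p$ and $ab\not\leqslant\phi(p)$ implies $a\leqslant p$ or $b\leqslant\delta(p)$. *)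

(* Defs.v *)
From HB Require Import structures.
From mathcomp Require Import all_boot all_order.
From mathcomp Require Import boolp classical_sets cardinality.

Set Implicit Arguments.
Unset Strict Implicit.
Unset Printing Implicit Defensive.

Import Order.TTheory.
Local Open Scope order_scope.
Local Open Scope classical_set_scope.

(* [supremums A] and [infimums A] are the sets of least upper bounds and of
   greatest lower bounds of [A]; each has at most one element, so
   [supremums A m] says that [m] is the join of [A], including [A = set0]. *)

HB.mixin Record isCompleteLattice d L of Order.TBLattice d L := {
  has_joins : forall A : set L, exists m : L, supremums A m;
  has_meets : forall A : set L, exists m : L, infimums A m
}.

#[short(type="completeLatticeType")]
HB.structure Definition CompleteLattice d :=
  { L of Order.TBLattice d L & isCompleteLattice d L }.

HB.mixin Record isMultiplicativeLattice d L of CompleteLattice d L := {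
  lmul : L -> L -> L;
  lmulA : associative lmul;
  lmulC : commutative lmul;
  lmul1 : left_id (\top : L) lmul;
  lmul_joins : forall (a : L) (A : set L) (m : L),
    supremums A m -> supremums [set lmul a x | x in A] (lmul a m)
}.

#[short(type="multLatticeType")]
HB.structure Definition MultiplicativeLattice d :=
  { L of CompleteLattice d L & isMultiplicativeLattice d L }.

Notation "a ** b" := (lmul a b) (at level 40, left associativity) : order_scope.

Definition compact_elt d (L : completeLatticeType d) (c : L) : Prop :=
  forall (A : set L) (m : L), supremums A m -> c <= m ->
  exists B : set L, [/\ B `<=` A, finite_set B &
    exists2 k : L, supremums B k & c <= k].

(* The empty product is [\top], so [compact_top] and [compact_mul] together
   give all finite products. *)
HB.mixin Record isCompactlyGenerated d L of MultiplicativeLattice d L := {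
  compactly_generated : forall a : L,
    exists2 C : set L, C `<=` @compact_elt d L & supremums C a;
  compact_top : compact_elt (\top : L);
  compact_mul : forall a b : L,
    compact_elt a -> compact_elt b -> compact_elt (a ** b)
}.

#[short(type="cgMultLatticeType")]
HB.structure Definition CGMultiplicativeLattice d :=
  { L of MultiplicativeLattice d L & isCompactlyGenerated d L }.

(* An order isomorphism automatically preserves arbitrary joins and meets:
   see [lattice_iso_supremums] and [lattice_iso_infimums]. *)
Record lattice_iso d1 d2 (L1 : multLatticeType d1) (L2 : multLatticeType d2) :=
  LatticeIso {
    iso_fun :> L1 -> L2;
    iso_inv : L2 -> L1;
    iso_funK : cancel iso_fun iso_inv;
    iso_invK : cancel iso_inv iso_fun;
    iso_le : {mono iso_fun : a b / a <= b};
    iso_mul : {morph iso_fun : a b / a ** b}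
  }.

Lemma lattice_iso_supremums d1 d2 (L1 : multLatticeType d1)
    (L2 : multLatticeType d2) (f : lattice_iso L1 L2) (A : set L1) (m : L1) :
  supremums (f @` A) (f m) <-> supremums A m.
Proof.
split=> -[ubm lbm]; split.
- by move=> x Ax; rewrite -(iso_le f); apply: ubm; exists x.
- move=> y uby; rewrite -(iso_le f); apply: lbm => _ [x Ax <-].
  by rewrite iso_le; apply: uby.
- by move=> _ [x Ax <-]; rewrite iso_le; apply: ubm.
- move=> y uby; rewrite -(iso_invK f y) iso_le; apply: lbm => x Ax.
  by rewrite -(iso_le f) iso_invK; apply: uby; exists x.
Qed.

Lemma lattice_iso_infimums d1 d2 (L1 : multLatticeType d1)
    (L2 : multLatticeType d2) (f : lattice_iso L1 L2) (A : set L1) (m : L1) :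
  infimums (f @` A) (f m) <-> infimums A m.
Proof.
split=> -[lbm ubm]; split.
- by move=> x Ax; rewrite -(iso_le f); apply: lbm; exists x.
- move=> y lby; rewrite -(iso_le f); apply: ubm => _ [x Ax <-].
  by rewrite iso_le; apply: lby.
- by move=> _ [x Ax <-]; rewrite iso_le; apply: lbm.
- move=> y lby; rewrite -(iso_invK f y) iso_le; apply: ubm => x Ax.
  by rewrite -(iso_le f) iso_invK; apply: lby; exists x.
Qed.

Definition expansion_function d (L : multLatticeType d) (delta : L -> L) : Prop :=
  (forall a, a <= delta a) /\ {homo delta : a b / a <= b}.

Definition reducing_function d (L : multLatticeType d) (phi : L -> L) : Prop :=
  forall a, phi a <= a.

Definition global_property d1 d2 (L1 : multLatticeType d1)
    (L2 : multLatticeType d2) (beta1 : L1 -> L1) (beta2 : L2 -> L2) : Prop :=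
  forall (f : lattice_iso L1 L2) (a : L2),
    beta1 (iso_inv f a) = iso_inv f (beta2 a).

Definition proper_elt d (L : multLatticeType d) (p : L) : Prop := p < \top.

Definition phi_delta_primary d (L : multLatticeType d) (phi delta : L -> L)
    (p : L) : Prop :=
  proper_elt p /\
  forall a b : L, a ** b <= p -> ~~ (a ** b <= phi p) ->
    a <= p \/ b <= delta p.

(* Main.v *)
Require Import Defs.
From mathcomp Require Import all_boot all_order.

(** Being phi-delta-primary is expressed by the order, the multiplication and
    the two values [phi a] and [delta a]. An isomorphism preserves the first
    two by definition; the global property says exactly that it carries the
    values at [a] to the values at [f a] ([global_property_iso]). Hence every
    inequality in the condition for [f a], tested at images [f x] and [f y],
    is equivalent to the corresponding inequality for [a]. Since [f] is
    surjective, testing at images loses nothing. *)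

Import Order.TTheory.
Local Open Scope order_scope.

(** The global property is phrased with the inverse map; applied at [f a] and
    transported back by [f], it says that [f] intertwines the two functions,
    the form in which values at [f a] can be rewritten. *)
Lemma global_property_iso {d1 d2 : Order.disp_t}
    {L1 : multLatticeType d1} {L2 : multLatticeType d2}
    {beta1 : L1 -> L1} {beta2 : L2 -> L2}
    (hbeta : global_property beta1 beta2) (f : lattice_iso L1 L2) (a : L1) :
  beta2 (f a) = f (beta1 a).
Proof. by rewrite -{2}(iso_funK f a) hbeta iso_invK. Qed.

Lemma lattice_iso_proper {d1 d2 : Order.disp_t}
    {L1 : multLatticeType d1} {L2 : multLatticeType d2}
    (f : lattice_iso L1 L2) (a : L1) :
  proper_elt a -> proper_elt (f a).
Proof.
move=> ha; apply: (@lt_le_trans _ _ (f \top)); last exact: lex1.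
by rewrite (leW_mono (iso_le f)).
Qed.

Theorem theorem2p45 (d1 d2 : Order.disp_t)
    (L1 : cgMultLatticeType d1) (L2 : cgMultLatticeType d2)
    (delta1 : L1 -> L1) (delta2 : L2 -> L2)
    (hdelta1 : expansion_function delta1) (hdelta2 : expansion_function delta2)
    (hdelta : global_property delta1 delta2)
    (phi1 : L1 -> L1) (phi2 : L2 -> L2)
    (hphi1 : reducing_function phi1) (hphi2 : reducing_function phi2)
    (hphi : global_property phi1 phi2)
    (f : lattice_iso L1 L2) (a : L1) (ha : proper_elt a) :
  phi_delta_primary phi1 delta1 a <-> phi_delta_primary phi2 delta2 (f a).
Proof.
rewrite /phi_delta_primary (global_property_iso hphi) (global_property_iso hdelta).
split=> -[_ prim]; split=> //.
- exact: lattice_iso_proper.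
- move=> x y; rewrite -(iso_invK f x) -(iso_invK f y) -iso_mul !iso_le.
  exact: prim.
- by move=> x y; have := prim (f x) (f y); rewrite -iso_mul !iso_le.
Qed.
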